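(* Let $X$ be a finite biquandle, let $A$ be an abelian group, let $W$ be a biquandle arrow weight for $X$ with coefficients in $A$, and let $S\subset \mathrm{Hom}(X,X)$ be a set of biquandle endomorphisms of $X$. Then the weighted quiver $\mathcal{Q}_{X,W,S}(K)$ is an invariant of oriented classical and virtual knots $K$. That is, if $D$ and $D'$ are Gauss diagrams representing the same oriented (classical or virtual) knot, then the weighted quivers $\mathcal{Q}_{X,W,S}(D)$ and $\mathcal{Q}_{X,W,S}(D')$ are isomorphic as directed multigraphs with $A$-valued vertex weights.
   Context: **Biquandles.** A biquandle is a set $X$ with two binary operations $\underline{\triangleright},\overline{\triangleright}$ such that for all $x,y,z\in X$: (i) $x\,\underline{\triangleright}\,x=x\,\overline{\triangleright}\,x$; (ii) the maps $\alpha_y,\beta_y:X\to X$, $\alpha_y(x)=x\,\overline{\triangleright}\,y$, $\beta_y(x)=x\,\underline{\triangleright}\,y$, and the map $X\times X\to X\times X$, $(x,y)\mapsto (y\,\overline{\triangleright}\,x,\ x\,\underline{\triangleright}\,y)$, are bijective; (iii) $(x\,\underline{\triangleright}\,y)\,\underline{\triangleright}\,(z\,\underline{\triangleright}\,y)=(x\,\underline{\triangleright}\,z)\,\underline{\triangleright}\,(y\,\overline{\triangleright}\,z)$, $(x\,\underline{\triangleright}\,y)\,\overline{\triangleright}\,(z\,\underline{\triangleright}\,y)=(x\,\overline{\triangleright}\,z)\,\underline{\triangleright}\,(y\,\overline{\triangleright}\,z)$, $(x\,\overline{\triangleright}\,y)\,\overline{\triangleright}\,(z\,\overline{\triangleright}\,y)=(x\,\overline{\triangleright}\,z)\,\overline{\triangleright}\,(y\,\underline{\triangleright}\,z)$.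 A biquandle endomorphism is a map $\phi:X\to X$ with $\phi(x\,\underline{\triangleright}\,x')=\phi(x)\,\underline{\triangleright}\,\phi(x')$ and $\phi(x\,\overline{\triangleright}\,x')=\phi(x)\,\overline{\triangleright}\,\phi(x')$ for all $x,x'\in X$; $\mathrm{Hom}(X,X)$ is the set of these. **Gauss diagrams.** A Gauss diagram is an oriented circle with finitely many arrows (directed chords with distinct endpoints on the circle), each with a sign $\pm1$, up to orientation-preserving homeomorphism of the circle. The arrows correspond to the real crossings of an oriented virtual knot diagram; each points from the overcrossing point (tail) to the undercrossing point (head), and its sign is the local writhe. Oriented virtual knots are the equivalence classes of Gauss diagrams under the Gauss diagram Reidemeister moves, generated by: (I) adding or removing an arrow of any sign and direction whose two endpoints are adjacent on the circle; (II) adding or removing two arrows of opposite signs whose tails are adjacent and whose heads are adjacent; (III) given three positive arrows $p,q,r$ and three disjoint arcs of the circle which contain, in the order of the orientation and with no other endpoints, (head of $p$, head of $q$), (tail of $p$, head of $r$), (tail of $q$, tail of $r$) respectively, reversing the order of the two endpoints in each of the three arcs (or the inverse of this). (The other oriented versions of move III are consequences of these.) Classical knots are the virtual knots represented by Gauss diagrams of classical knot diagrams. **Colorings.** The segments of a Gauss diagram are the components of the circle minus the arrow endpoints. An $X$-coloring assigns an element of $X$ to each segment so that at each arrow there are $x,y\in X$ such that: if the arrow is positive, the segments just before and just after its head are colored $x$ and $x\,\underline{\triangleright}\,y$, and those just before and just after its tail are colored $y\,\overline{\triangleright}\,x$ and $y$; if the arrow is negative, the segments just before and just after its head are colored $x\,\underline{\triangleright}\,y$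 and $x$, and those just before and just after its tail are colored $y$ and $y\,\overline{\triangleright}\,x$. The arrow is then labeled by the ordered pair $(x,y)$. If two Gauss diagrams differ by a Reidemeister move, each $X$-coloring of one determines a unique $X$-coloring of the other agreeing with it outside the neighborhood of the move; such a pair of $X$-colored diagrams is said to be related by an $X$-colored Reidemeister move. Applying $\phi\in\mathrm{Hom}(X,X)$ to all segment colors of an $X$-coloring $f$ gives an $X$-coloring $\phi(f)$. **Biquandle arrow weights.** For a function $W:(X\times X)\times(X\times X)\to A$ and an $X$-colored Gauss diagram, let $\Sigma_D\in A$ be the sum, over all pairs of arrows that cross each other (i.e. whose endpoints interleave on the circle), of $\varepsilon\varepsilon' W((a,b),(c,d))$, where $(a,b),(c,d)$ are the labels and $\varepsilon,\varepsilon'$ the signs of the two arrows. The first arrow of a crossing pair (label $(a,b)$) is the one for which, travelling along the oriented circle from its tail to its head, one meets the tail of the other arrow. A biquandle arrow weight for $X$ with coefficients in $A$ is such a function $W$ for which $\Sigma_D$ is unchanged by all $X$-colored Gauss diagram Reidemeister moves. **Weighted quiver.** For a Gauss diagram $D$ representing $K$, $\mathcal{Q}_{X,W,S}(D)$ (also written $\mathcal{Q}_{X,W,S}(K)$) is the directed multigraph whose vertices are the $X$-colorings of $D$, with one directed edge from $f$ to $\phi(f)$ for each vertex $f$ and each $\phi\in S$, where each vertex $f$ is given as weight the element $\Sigma_D\in A$ computed from the coloring $f$. *)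

(* Defs.v *)
From HB Require Import structures.
From Stdlib Require Import Relation_Operators.
From mathcomp Require Import all_boot all_order all_algebra.
Set Implicit Arguments.
Unset Strict Implicit.
Unset Printing Implicit Defensive.

Import GRing.Theory.

Reserved Notation "x \under y" (at level 40, left associativity).
Reserved Notation "x \over y" (at level 40, left associativity).

HB.mixin Record isBiquandle X := {
  bunder : X -> X -> X;
  bover : X -> X -> X;
  biq_diag : forall x, bunder x x = bover x x;
  bover_bij : forall y, bijective (fun x => bover x y);
  bunder_bij : forall y, bijective (fun x => bunder x y);
  bswitch_bij : bijective (fun p : X * X => (bover p.2 p.1, bunder p.1 p.2));
  bunder_under : forall x y z,
    bunder (bunder x y) (bunder z y) = bunder (bunder x z) (bover y z);
  bunder_over : forall x y z,
    bover (bunder x y) (bunder z y) = bunder (bover x z) (bover y z);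
  bover_over : forall x y z,
    bover (bover x y) (bover z y) = bover (bover x z) (bunder y z)
}.

#[short(type="biquandleType")]
HB.structure Definition Biquandle := {X of isBiquandle X}.

#[short(type="finBiquandleType")]
HB.structure Definition FinBiquandle := {X of isBiquandle X & Finite X}.

Notation "x \under y" := (bunder x y).
Notation "x \over y" := (bover x y).

Definition is_biq_endo (X : finBiquandleType) (phi : {ffun X -> X}) : bool :=
  [forall x, forall y, (phi (x \under y) == phi x \under phi y)
                    && (phi (x \over y) == phi x \over phi y)].

Definition biq_endo (X : finBiquandleType) : finType :=
  {phi : {ffun X -> X} | is_biq_endo phi}.

(* An arrow is a name together with its sign (true for +1); arrows with the
   same name and different signs are simply different arrows. *)
Definition arrow : Type := (nat * bool)%type.
Definition endpoint : Type := (arrow * bool)%type.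
Definition tail_of (a : arrow) : endpoint := (a, false).
Definition head_of (a : arrow) : endpoint := (a, true).
Definition arrow_sign (a : arrow) : int := if a.2 then 1%R else (-1)%R.

(* A Gauss diagram is encoded by the endpoints met while travelling once along
   the circle from a base point that is not an endpoint: each endpoint occurs
   at most once, and with it the other endpoint of the same arrow.  The choices
   of base point and of arrow names are divided out by gauss_homeo. *)
Definition gauss_code (w : seq endpoint) : bool :=
  uniq w && all (fun e : endpoint => (e.1, ~~ e.2) \in w) w.

Record gauss_diagram := GaussDiagram {
  code :> seq endpoint;
  codeP : gauss_code code
}.

Definition arrows (D : gauss_diagram) : seq arrow :=
  [seq e.1 | e <- code D & e.2].

Definition gauss_homeo (D D' : gauss_diagram) : Prop :=
  exists (s : arrow -> arrow) (k : nat),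
    [/\ {in arrows D &, injective s},
        {in arrows D, forall a, (s a).2 = a.2}
      & code D' = rot k [seq (s e.1, e.2) | e <- code D]].

(* The local pictures of the moves.  A pair (b, b') says that b' replaces b in
   one arc of the circle; the list gives the arcs in the order in which they
   are met from the base point.  In moves II and III that order is arbitrary. *)
Inductive local_move : seq (seq endpoint * seq endpoint) -> Prop :=
| MoveI (a : arrow) (e : bool) :
    local_move [:: ([::], [:: (a, e); (a, ~~ e)])]
| MoveII (a b : arrow) (ts hs : seq endpoint) bs of
    a.2 != b.2
  & perm_eq ts [:: tail_of a; tail_of b]
  & perm_eq hs [:: head_of a; head_of b]
  & perm_eq bs [:: ([::], ts); ([::], hs)] :
    local_move bs
| MoveIII (p q r : arrow) bs of
    p.2 & q.2 & r.2
  & perm_eq bs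
      [:: ([:: head_of p; head_of q], [:: head_of q; head_of p]);
          ([:: tail_of p; head_of r], [:: head_of r; tail_of p]);
          ([:: tail_of q; tail_of r], [:: tail_of r; tail_of q])] :
    local_move bs.

Fixpoint weave (u : seq endpoint) (l : seq (seq endpoint * seq endpoint)) :
    seq endpoint :=
  if l is (b, v) :: l' then u ++ b ++ weave v l' else u.

(* The move replaces b by b' for each ((b, b'), v) in l, and leaves unchanged
   the initial part u of the code and the part v following each b. *)
Definition move_at (D D' : gauss_diagram) (u : seq endpoint)
    (l : seq (seq endpoint * seq endpoint * seq endpoint)) : Prop :=
  [/\ local_move [seq x.1 | x <- l],
      code D = weave u [seq (x.1.1, x.2) | x <- l]
    & code D' = weave u [seq (x.1.2, x.2) | x <- l]].

Definition reidemeister_move (D D' : gauss_diagram) : Prop :=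
  exists u l, move_at D D' u l.

Definition gauss_step (D D' : gauss_diagram) : Prop :=
  gauss_homeo D D' \/ reidemeister_move D D'.

Definition same_virtual_knot : gauss_diagram -> gauss_diagram -> Prop :=
  clos_refl_sym_trans gauss_diagram gauss_step.

(* A code with n endpoints has n + 1 gaps: before the first endpoint, between
   consecutive ones, and after the last.  The first and last gaps are the two
   parts of the segment containing the base point, so segment colors are gap
   colors that agree there (see is_coloring).  For n = 0 there is a single
   gap, the whole circle. *)
Definition gap_colors (X : Type) (D : gauss_diagram) : Type :=
  (size (code D)).+1.-tuple X.

Definition color_before (X : Type) (D : gauss_diagram) (c : gap_colors X D)
  (e : endpoint) : X := nth (thead c) c (index e (code D)).

Definition color_after (X : Type) (D : gauss_diagram) (c : gap_colors X D)
  (e : endpoint) : X := nth (thead c) c (index e (code D)).+1.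

Definition labeled (X : finBiquandleType) (D : gauss_diagram)
    (c : gap_colors X D) (a : arrow) (xy : X * X) : bool :=
  let: (x, y) := xy in
  if a.2 then
    [&& color_before c (head_of a) == x,
        color_after c (head_of a) == x \under y,
        color_before c (tail_of a) == y \over x
      & color_after c (tail_of a) == y]
  else
    [&& color_before c (head_of a) == x \under y,
        color_after c (head_of a) == x,
        color_before c (tail_of a) == y
      & color_after c (tail_of a) == y \over x].

Definition is_coloring (X : finBiquandleType) (D : gauss_diagram)
    (c : gap_colors X D) : bool :=
  (last (thead c) c == thead c)
  && all (fun a => [exists xy : X * X, labeled c a xy]) (arrows D).

(* The only pair xy that can satisfy labeled c a xy. *)
Definition label (X : finBiquandleType) (D : gauss_diagram)
    (c : gap_colors X D) (a : arrow) : X * X :=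
  if a.2 then (color_before c (head_of a), color_after c (tail_of a))
  else (color_after c (head_of a), color_before c (tail_of a)).

(* e lies on the arc travelled from the tail to the head of a. *)
Definition meets (D : gauss_diagram) (a : arrow) (e : endpoint) : bool :=
  e \in arc (code D) (tail_of a) (head_of a).

Definition crosses (D : gauss_diagram) (a b : arrow) : bool :=
  (a != b) && (meets D a (tail_of b) != meets D a (head_of b)).

(* Each unordered pair of crossing arrows contributes exactly once, as the
   ordered pair (a, b) in which a is the first arrow. *)
Definition Sigma (X : finBiquandleType) (A : zmodType)
    (W : (X * X) * (X * X) -> A) (D : gauss_diagram) (c : gap_colors X D) : A :=
  (\sum_(a <- arrows D) \sum_(b <- arrows D |
      crosses D a b && meets D a (tail_of b))
    W (label c a, label c b) *~ (arrow_sign a * arrow_sign b))%R.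

(* The gap colors c and c' agree on every gap, or part of a gap, lying in one
   of the parts of the code left unchanged by a move (notations of move_at);
   a part with n endpoints meets n + 1 gaps. *)
Fixpoint agree_outside (X : Type) (c c' : seq X) (u : seq endpoint)
    (l : seq (seq endpoint * seq endpoint * seq endpoint)) : Prop :=
  take (size u).+1 c = take (size u).+1 c' /\
  if l is (b, b', v) :: l' then
    agree_outside (drop (size u + size b) c) (drop (size u + size b') c') v l'
  else True.

Definition colored_move (X : finBiquandleType) (D D' : gauss_diagram)
    (c : gap_colors X D) (c' : gap_colors X D') : Prop :=
  [/\ is_coloring c, is_coloring c'
    & exists u l, move_at D D' u l /\ agree_outside c c' u l].

Definition arrow_weight (X : finBiquandleType) (A : zmodType)
    (W : (X * X) * (X * X) -> A) : Prop :=
  forall (D D' : gauss_diagram) (c : gap_colors X D) (c' : gap_colors X D'),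
    colored_move c c' -> Sigma W c = Sigma W c'.

Definition coloring (X : finBiquandleType) (D : gauss_diagram) : Type :=
  {c : gap_colors X D | is_coloring c}.

Definition endo_colors (X : finBiquandleType) (D : gauss_diagram)
    (phi : biq_endo X) (c : gap_colors X D) : gap_colors X D :=
  map_tuple (val phi) c.

Lemma color_before_endo (X : finBiquandleType) (D : gauss_diagram)
    (phi : biq_endo X) (c : gap_colors X D) (e : endpoint) :
  color_before (endo_colors phi c) e = val phi (color_before c e).
Proof.
rewrite /color_before (_ : thead _ = val phi (thead c)); last first.
  by case/tupleP: c => x t; rewrite !theadE.
have le_ec: index e (code D) < size c by rewrite size_tuple ltnS index_size.
by rewrite (nth_map (thead c)).
Qed.

Lemma color_after_endo (X : finBiquandleType) (D : gauss_diagram)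
    (phi : biq_endo X) (c : gap_colors X D) (e : endpoint) :
  color_after (endo_colors phi c) e = val phi (color_after c e).
Proof.
rewrite /color_after (_ : thead _ = val phi (thead c)); last first.
  by case/tupleP: c => x t; rewrite !theadE.
have [lt_ec | le_ce] := ltnP (index e (code D)).+1 (size c).
  by rewrite (nth_map (thead c)).
by rewrite !nth_default ?size_map.
Qed.

Lemma endo_coloring (X : finBiquandleType) (D : gauss_diagram)
    (phi : biq_endo X) (c : gap_colors X D) :
  is_coloring c -> is_coloring (endo_colors phi c).
Proof.
have phiM x y : (val phi (x \under y) = val phi x \under val phi y)
              * (val phi (x \over y) = val phi x \over val phi y).
  by have /forallP/(_ x)/forallP/(_ y)/andP[/eqP-> /eqP->] := valP phi.
case/andP=> /eqP closed_c /allP col_c; apply/andP; split.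
  rewrite (_ : thead _ = val phi (thead c)); last first.
    by case/tupleP: (c) => x t; rewrite !theadE.
  by rewrite /endo_colors /= last_map closed_c.
apply/allP=> a /col_c/existsP[[x y] lab_a].
apply/existsP; exists (val phi x, val phi y); move: lab_a.
rewrite /labeled !color_before_endo !color_after_endo -!phiM.
by case: a.2 => /and4P[/eqP-> /eqP-> /eqP-> /eqP->]; rewrite !eqxx.
Qed.

Definition coloring_endo (X : finBiquandleType) (D : gauss_diagram)
    (phi : biq_endo X) (f : coloring X D) : coloring X D :=
  exist _ (endo_colors phi (sval f)) (endo_coloring phi (svalP f)).

Record weighted_quiver (A : Type) := WeightedQuiver {
  vertex : Type;
  edge : Type;
  edge_src : edge -> vertex;
  edge_tgt : edge -> vertex;
  vertex_weight : vertex -> A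
}.

Definition quiver_iso (A : Type) (Q Q' : weighted_quiver A) : Prop :=
  exists (fV : vertex Q -> vertex Q') (fE : edge Q -> edge Q'),
    [/\ bijective fV, bijective fE,
        forall e, edge_src (fE e) = fV (edge_src e),
        forall e, edge_tgt (fE e) = fV (edge_tgt e)
      & forall v, vertex_weight (fV v) = vertex_weight v].

Definition coloring_quiver (X : finBiquandleType) (A : zmodType)
    (W : (X * X) * (X * X) -> A) (S : {set biq_endo X}) (D : gauss_diagram) :
    weighted_quiver A :=
  {| vertex := coloring X D;
     edge := (coloring X D * {phi : biq_endo X | phi \in S})%type;
     edge_src := fun e => e.1;
     edge_tgt := fun e => coloring_endo (val e.2) e.1;
     vertex_weight := fun f => Sigma W (sval f) |}.

(* Main.v *)
Require Import Defs.
From mathcomp Require Import all_boot all_order all_algebra.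

(** The vertices of the quiver are the colorings of the diagram, and its edges
    are read off from the action of the endomorphisms on the vertices.  So two
    diagrams have isomorphic quivers as soon as their colorings are in a
    bijection that commutes with the endomorphisms and preserves Sigma
    ([coloring_match]).  This is an equivalence relation on diagrams, and it
    remains to find such a bijection for each generating step.

    Let a Reidemeister move replace some arcs of the circle.  An arrow has both
    endpoints in these arcs or both outside, so the coloring conditions separate
    into conditions inside the arcs and conditions outside.  Inside, the move is
    [rigid]: the colors that enter the arcs determine all colors of the new
    arcs, a coloring of the new arcs with these entering colors exists, and the
    colors that leave the arcs are the old ones.  Hence a coloring of one
    diagram extends to exactly one coloring of the other that agrees with it
    outside ([extend_coloring], [extension_uniq]).  Agreement outside is
    preserved when an endomorphism is applied to both colorings, so the
    bijection commutes with endomorphisms; it preserves Sigma by the definition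
    of an arrow weight.

    Rigidity is where the biquandle axioms enter ([local_move_rigid]).  At a
    crossing, one color next to the head and one next to the tail determine the
    other two, and both may be chosen freely; this is the bijectivity of the
    biquandle maps and settles move II.  For move I one also needs that the
    switch map carries the diagonal of X x X bijectively to itself, which holds
    because x \under x = x \over x and X is finite.  For move III the two sides
    of the move compute the outgoing colors from the three incoming ones, and
    the three exchange laws say that the results are equal ([yang_baxter]).

    A change of base point and of arrow names turns the cyclic list of colors;
    it carries the endpoint with its two neighboring colors to the renamed
    endpoint with the same colors, hence preserves labels, the interleaving of
    the arrows, and Sigma ([homeo_match]). *)

Set Implicit Arguments.
Unset Strict Implicit.
Unset Printing Implicit Defensive.

(** * Sequences *)

Lemma size_split (T : Type) (t : seq T) m n : size t = m + n ->
  exists t1 t2, [/\ t = t1 ++ t2, size t1 = m & size t2 = n].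
Proof.
move=> sz; exists (take m t), (drop m t).
by rewrite cat_take_drop size_takel ?sz ?leq_addr // size_drop sz addKn.
Qed.

Lemma drop_cons_last (T : Type) (x : T) t1 t2 :
  drop (size t1) (x :: t1 ++ t2) = last x t1 :: t2.
Proof. by elim: t1 x => [|y t1 IH] x //=; rewrite drop0. Qed.

Lemma perm_map_lift (T1 T2 : eqType) (f : T1 -> T2) s s0 :
  perm_eq (map f s) s0 -> exists2 s', perm_eq s s' & map f s' = s0.
Proof.
case: s => [|x s]; first by rewrite perm_sym => /perm_nilP->; exists [::].
rewrite perm_sym => /(perm_iotaP (f x))[Is pI ->].
exists [seq nth x (x :: s) i | i <- Is].
  rewrite -[X in perm_eq X _](mkseq_nth x) perm_sym perm_map //.
  by rewrite size_map in pI.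
rewrite -map_comp; apply/eq_in_map=> i /=.
by rewrite (perm_mem pI) mem_iota size_map => lti; rewrite -(nth_map x (f x) f).
Qed.

Lemma perm_pair (T : eqType) (s : seq T) x y :
  perm_eq s [:: x; y] -> exists b : bool, s = if b then [:: x; y] else [:: y; x].
Proof.
move=> ps; have /= := perm_size ps; case: s ps => [|u [|v []]] // ps _.
have := mem_head u [:: v]; rewrite (perm_mem ps) !inE => /orP[]/eqP ?; subst u.
  by exists true; move: ps; rewrite perm_cons => /perm_small_eq ->.
exists false; move: ps; rewrite perm_sym (perm_catC [:: x] [:: y]) perm_cons.
by move=> /perm_small_eq ->.
Qed.

Lemma in_seq3 (T : eqType) (P : T -> Prop) x y z :
  {in [:: x; y; z], forall i, P i} -> [/\ P x, P y & P z].
Proof. by move=> H; split; apply: H; rewrite !inE eqxx ?orbT. Qed.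

Lemma index_map_in (T1 T2 : eqType) (f : T1 -> T2) (s : seq T1) x :
  {in s &, injective f} -> x \in s -> index (f x) (map f s) = index x s.
Proof.
move=> + xs; elim: s xs => //= z s IH xs inj.
rewrite (inj_in_eq inj) ?mem_head //; case: eqP => // zx; congr _.+1.
apply: IH; first by move: xs; rewrite inE => /predU1P[e|//]; case: zx.
by move=> y y' ys y's; apply: inj; rewrite inE ?ys ?y's orbT.
Qed.

(** * Crossings of a finite biquandle *)

Definition positive_crossing (X : finBiquandleType) (h t : X * X) : Prop :=
  h.2 = h.1 \under t.2 /\ t.1 = t.2 \over h.1.

(** The pairs hold the colors before and after the head and the tail; a negative
    crossing is a positive one with both strands reversed. *)
Definition crossing (X : finBiquandleType) (s : bool) (h t : X * X) : Prop :=
  if s then positive_crossing h t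
  else positive_crossing (h.2, h.1) (t.2, t.1).

Section Crossings.
Variable X : finBiquandleType.
Implicit Types (x y z m k : X) (h t : X * X).

Definition pick_side (b : bool) (p : X * X) : X := if b then p.1 else p.2.

(** The map that has to be inverted is, in the four cases, [bover] in its first
    argument, the identity, the switch map (x, y) |-> (y \over x, x \under y), and
    [bunder] in its first argument. *)
Lemma positive_crossing_ex bh bt x y :
  exists h t, [/\ positive_crossing h t, pick_side bh h = x & pick_side bt t = y].
Proof.
suff [a [b [xE yE]]] : exists a b, pick_side bh (a, a \under b) = x /\
    pick_side bt (b \over a, b) = y.
  by exists (a, a \under b), (b \over a, b).
case: bh bt => [] [] /=.
- by have [g _ gK] := bover_bij x; exists x, (g y); rewrite gK.
- by exists x, y.
- have [g _ gK] := @bswitch_bij X.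
  by exists (g (y, x)).1, (g (y, x)).2; case: (gK (y, x)).
- by have [g _ gK] := bunder_bij y; exists (g x), y; rewrite gK.
Qed.

Lemma positive_crossing_uniq bh bt h t h' t' :
    positive_crossing h t -> positive_crossing h' t' ->
    pick_side bh h = pick_side bh h' -> pick_side bt t = pick_side bt t' ->
  h = h' /\ t = t'.
Proof.
case: h t h' t' => [h0 h1] [t0 t1] [h0' h1'] [t0' t1'].
rewrite /positive_crossing /= => -[-> ->] [-> ->].
suff H : pick_side bh (h0, h0 \under t1) = pick_side bh (h0', h0' \under t1') ->
         pick_side bt (t1 \over h0, t1) = pick_side bt (t1' \over h0', t1') ->
         h0 = h0' /\ t1 = t1'.
  by move=> /H{}H /H[-> ->].
case: bh bt => [] [] /= E F; subst; split=> //.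
- exact: bij_inj (bover_bij h0') _ _ F.
- by have /(_ (h0, t1) (h0', t1')) := bij_inj (@bswitch_bij X);
    rewrite /= E F => /(_ erefl) [].
- by have /(_ (h0, t1) (h0', t1')) := bij_inj (@bswitch_bij X);
    rewrite /= E F => /(_ erefl) [].
- exact: bij_inj (bunder_bij t1') _ _ E.
Qed.

Lemma positive_crossing_in (x y : X) :
  exists m k, positive_crossing (x, m) (y, k).
Proof.
have [[h0 h1] [[t0 t1] /= [P <- <-]]] := positive_crossing_ex true true x y.
by exists h1, t1.
Qed.

Lemma positive_crossing_in_uniq (x y m k m' k' : X) :
    positive_crossing (x, m) (y, k) -> positive_crossing (x, m') (y, k') ->
  m = m' /\ k = k'.
Proof.
move=> P P'.
by have [] := positive_crossing_uniq (bh := true) (bt := true) P P' erefl erefl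
  => -[->] [->].
Qed.

(** The two passages of a strand colored x, m, z: the first one for [b = true],
    the second one otherwise. *)
Definition passage (b : bool) (x m z : X) : X * X :=
  if b then (x, m) else (m, z).

(** The switch map sends (x, x) to a diagonal pair, so the map is injective;
    finiteness makes it surjective. *)
Lemma bunder_diag_bij : bijective (fun x => x \under x).
Proof.
apply: injF_bij => x y /= E.
have /(_ (x, x) (y, y)) := bij_inj (@bswitch_bij X).
by rewrite /= -!biq_diag E => /(_ erefl) [].
Qed.

(** The switch image of (x, y) is then diagonal, hence also the image of a
    diagonal pair (z, z); the switch map is injective. *)
Lemma positive_crossing_diag x y :
  x \under y = y \over x -> x = y.
Proof.
have [g _ gK] := bunder_diag_bij => E.
set z := g (y \over x).
have /(_ (x, y) (z, z)) := bij_inj (@bswitch_bij X).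
by rewrite /= -biq_diag E gK => /(_ erefl) [-> ->].
Qed.

Definition kink s (e : bool) x m z : Prop :=
  if e then crossing s (x, m) (m, z) else crossing s (m, z) (x, m).

Lemma kink_ex s e x : exists m, kink s e x m x.
Proof.
have [g _ gK] := bunder_diag_bij.
case: s e => [] []; rewrite /kink /crossing /positive_crossing /=.
- by exists (x \under x); rewrite -biq_diag.
- by exists (g x); rewrite -biq_diag gK.
- by exists (g x); rewrite -biq_diag gK.
- by exists (x \under x); rewrite -biq_diag.
Qed.

Lemma kink_uniq s e x m z m' z' :
  kink s e x m z -> kink s e x m' z' -> m = m' /\ z = x.
Proof.
have inj := bij_inj bunder_diag_bij.
case: s e => [] []; rewrite /kink /crossing /positive_crossing /=.
- by move=> [-> /positive_crossing_diag E] [-> /positive_crossing_diag F]; subst.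
- by rewrite -!biq_diag => -[-> ->] [_ /inj].
- by rewrite -!biq_diag => -[-> ->] [/inj].
- by move=> [-> /positive_crossing_diag E] [-> /positive_crossing_diag F]; subst.
Qed.

(** Move II: a strand colored r, m, r' carries the heads of a positive and a
    negative arrow, and one colored q, k, q' their tails.  The positive arrow
    comes first on them according to [oh] and [ot]. *)
Definition poke (oh ot : bool) (r m r' q k q' : X) : Prop :=
  positive_crossing (passage oh r m r') (passage ot q k q') /\
  positive_crossing (passage oh r' m r) (passage ot q' k q).

Lemma poke_ex oh ot r q : exists m k, poke oh ot r m r q k q.
Proof.
have [[h0 h1] [[t0 t1] [pos hE tE]]] := positive_crossing_ex oh ot r q.
exists (if oh then h1 else h0), (if ot then t1 else t0).
by case: oh ot hE tE => [] [] /= <- <-.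
Qed.

(** The two crossings share the middle colors m and k, and these determine a
    crossing. *)
Lemma poke_closed oh ot r m r' q k q' :
  poke oh ot r m r' q k q' -> r' = r /\ q' = q.
Proof.
case=> P N; have := positive_crossing_uniq (bh := ~~ oh) (bt := ~~ ot) P N.
by case: oh ot {P N} => [] [] /= [] // -[->] [->].
Qed.

Lemma poke_uniq oh ot r m r' q k q' m1 r1' k1 q1' :
    poke oh ot r m r' q k q' -> poke oh ot r m1 r1' q k1 q1' ->
  m = m1 /\ k = k1.
Proof.
move=> K K1; have [er eq] := poke_closed K; have [er1 eq1] := poke_closed K1.
subst r' q' r1' q1'; case: K K1 => [P _] [P1 _].
have := positive_crossing_uniq (bh := oh) (bt := ot) P P1.
by case: oh ot {P P1} => [] [] /= [] // -[->] [->].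
Qed.

(** Move III: A, B, C enter the three strands, and A1, B1, C1 and A2, B2, C2 leave
    them on the two sides of the move.  Two exchange laws give C1 = C2 and then
    B1 = B2 after cancelling [bover], and the third one becomes A1 = A2. *)
Lemma yang_baxter A B C m1 m2 m3 n1 n2 n3 A1 B1 C1 A2 B2 C2 :
    positive_crossing (A, m1) (B, m2) -> positive_crossing (m1, A1) (C, m3) ->
    positive_crossing (m2, B1) (m3, C1) ->
    positive_crossing (B, n2) (C, n3) -> positive_crossing (A, n1) (n3, C2) ->
    positive_crossing (n1, A2) (n2, B2) ->
  [/\ A1 = A2, B1 = B2 & C1 = C2].
Proof.
rewrite /positive_crossing /=.
(* E equates two expressions of the incoming color C, and G two of n2. *)
move=> [-> ->] [-> ->] [-> ->] [-> E] [-> F] [-> G]; subst n3.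
move: E G; rewrite bover_over => /(bij_inj (bover_bij _))/(bij_inj (bover_bij _)).
move=> <-; rewrite -bunder_over => /(bij_inj (bover_bij _)) <-.
by rewrite bunder_under.
Qed.

(** The two sides of move III have the same shape: the arrows p, q, r join strand
    1 to 2, strand 1 to 3 and strand 2 to 3, and the order of the two passages is
    reversed on every strand. *)
Definition triangle (b : bool) (A m1 A' B m2 B' C m3 C' : X) : Prop :=
  [/\ positive_crossing (passage b A m1 A') (passage b B m2 B'),
      positive_crossing (passage (~~ b) A m1 A') (passage b C m3 C')
    & positive_crossing (passage (~~ b) B m2 B') (passage (~~ b) C m3 C')].

Lemma triangle_ex b A B C :
  exists m1 A' m2 B' m3 C', triangle b A m1 A' B m2 B' C m3 C'.
Proof.
case: b.
  have [m1 [m2 P]] := positive_crossing_in A B.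
  have [A' [m3 Q]] := positive_crossing_in m1 C.
  have [B' [C' R]] := positive_crossing_in m2 m3.
  by exists m1, A', m2, B', m3, C'.
have [m2 [m3 R]] := positive_crossing_in B C.
have [m1 [C' Q]] := positive_crossing_in A m3.
have [A' [B' P]] := positive_crossing_in m1 m2.
by exists m1, A', m2, B', m3, C'.
Qed.

Lemma triangle_uniq b A B C m1 A1 m2 B1 m3 C1 n1 A2 n2 B2 n3 C2 :
    triangle b A m1 A1 B m2 B1 C m3 C1 -> triangle b A n1 A2 B n2 B2 C n3 C2 ->
  [/\ [:: m1; A1] = [:: n1; A2], [:: m2; B1] = [:: n2; B2]
    & [:: m3; C1] = [:: n3; C2]].
Proof.
case: b => -[/= P Q R] [/= P' Q' R'].
  have [? ?] := positive_crossing_in_uniq P P'; subst.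
  have [? ?] := positive_crossing_in_uniq Q Q'; subst.
  by have [-> ->] := positive_crossing_in_uniq R R'.
have [? ?] := positive_crossing_in_uniq R R'; subst.
have [? ?] := positive_crossing_in_uniq Q Q'; subst.
by have [-> ->] := positive_crossing_in_uniq P P'.
Qed.

Lemma triangle_ends b A B C m1 A1 m2 B1 m3 C1 n1 A2 n2 B2 n3 C2 :
    triangle b A m1 A1 B m2 B1 C m3 C1 ->
    triangle (~~ b) A n1 A2 B n2 B2 C n3 C2 ->
  [/\ A1 = A2, B1 = B2 & C1 = C2].
Proof.
case: b => -[/= P Q R] [/= P' Q' R']; first exact: yang_baxter P Q R R' Q' P'.
by have [-> -> ->] := yang_baxter P' Q' R' R Q P.
Qed.

End Crossings.

(** * Colorings as lists of passages *)

Notation word := (seq endpoint).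

Section Passages.
Variable X : eqType.
Implicit Types (x y : X) (t : seq X) (w : word).

(** Here x is the color before the first endpoint of w and t lists the colors
    after each endpoint. *)
Fixpoint passages x w t : seq (endpoint * (X * X)) :=
  match w, t with
  | e :: w', y :: t' => (e, (x, y)) :: passages y w' t'
  | _, _ => [::]
  end.

Lemma passages_cat x w1 w2 t1 t2 : size t1 = size w1 ->
  passages x (w1 ++ w2) (t1 ++ t2) =
    passages x w1 t1 ++ passages (last x t1) w2 t2.
Proof. by elim: w1 x t1 => [|e w1 IH] x [|y t1] //= [/IH->]. Qed.

Lemma unzip1_passages x w t : size t = size w -> unzip1 (passages x w t) = w.
Proof. by elim: w x t => [|e w IH] x [|y t] //= [/IH->]. Qed.

Lemma passagesE x0 x w t : uniq w -> size t = size w ->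
  passages x w t =
    [seq (e, (nth x0 (x :: t) (index e w), nth x0 t (index e w))) | e <- w].
Proof.
elim: w x t => [|e w IH] x [|y t] //= /andP[ew uw] [sz]; rewrite eqxx /=.
congr cons; rewrite (IH y t uw sz); apply/eq_in_map=> e' e'w.
by case: eqP ew => [->|_ _ //=]; rewrite e'w.
Qed.

End Passages.

Definition compatible (X : finBiquandleType) (ps : seq (endpoint * (X * X))) :=
  forall a h t, (head_of a, h) \in ps -> (tail_of a, t) \in ps ->
    crossing a.2 h t.

Definition closed_word (w : word) :=
  forall e, e \in w -> (e.1, ~~ e.2) \in w.

Section Colorings.
Variable X : finBiquandleType.
Implicit Types D : gauss_diagram.

Lemma compatible_sub (ps ps' : seq (endpoint * (X * X))) :
  {subset ps' <= ps} -> compatible ps -> compatible ps'.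
Proof. by move=> sub cp a h t /sub + /sub; apply: cp. Qed.

(** No arrow has one endpoint in ps1 and the other in ps2, so there is no
    condition relating the two lists. *)
Lemma compatible_cat (ps1 ps2 : seq (endpoint * (X * X))) :
    uniq (unzip1 (ps1 ++ ps2)) -> closed_word (unzip1 ps1) ->
    compatible ps1 -> compatible ps2 ->
  compatible (ps1 ++ ps2).
Proof.
rewrite /unzip1 map_cat cat_uniq => /and3P[_ /hasPn dis _] clo cp1 cp2.
have out a b b' h t : (a, b, h) \in ps1 -> (a, b', t) \in ps2 -> b' = ~~ b -> False.
  move=> /(map_f fst)/clo in1 /(map_f fst)/dis /negP + e.
  by apply; rewrite e.
move=> a h t; rewrite !mem_cat => /orP[] h1 /orP[] h2.
- exact: cp1.
- by case: (out _ _ _ _ _ h1 h2).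
- by case: (out _ _ _ _ _ h2 h1).
- exact: cp2.
Qed.

Definition gap_passages D (c : gap_colors X D) :=
  passages (thead c) (code D) (behead c).

Lemma gap_colorsE D (c : gap_colors X D) : c = thead c :: behead c :> seq X.
Proof. by case/tupleP: c => x t; rewrite theadE. Qed.

Lemma size_behead_colors D (c : gap_colors X D) :
  size (behead c) = size (code D).
Proof. by rewrite size_behead size_tuple. Qed.

Lemma gap_passagesE D (c : gap_colors X D) :
  gap_passages c =
    [seq (e, (color_before c e, color_after c e)) | e <- code D].
Proof.
have /andP[uD _] := codeP D.
rewrite /gap_passages (passagesE (thead c)) ?size_behead_colors //.
apply: eq_map => e.
by rewrite -gap_colorsE /color_before /color_after nth_behead.
Qed.

Lemma mem_gap_passages D (c : gap_colors X D) e p :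
  ((e, p) \in gap_passages c) =
    (e \in code D) && (p == (color_before c e, color_after c e)).
Proof.
rewrite gap_passagesE; apply/mapP/andP => [[e' ? [-> ->]] //|[? /eqP->]].
by exists e.
Qed.

Lemma endpoint_opp D e : e \in code D -> (e.1, ~~ e.2) \in code D.
Proof. by case/andP: (codeP D) => _ /allP; apply. Qed.

Lemma mem_arrows D a :
  ((a \in arrows D) = (head_of a \in code D)) *
  ((a \in arrows D) = (tail_of a \in code D)).
Proof.
have H : (a \in arrows D) = (head_of a \in code D).
  apply/mapP/idP => [[[a' b]]|ha]; last by exists (head_of a); rewrite ?mem_filter.
  by rewrite mem_filter /= => /andP[-> ?] ->.
by split=> //; rewrite H; apply/idP/idP => /endpoint_opp.
Qed.

Lemma crossing_labeled D (c : gap_colors X D) a :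
  reflect (crossing a.2 (color_before c (head_of a), color_after c (head_of a))
                        (color_before c (tail_of a), color_after c (tail_of a)))
          [exists xy, labeled c a xy].
Proof.
rewrite /crossing /positive_crossing /labeled.
apply: (iffP existsP) => [[[x y]]|].
  by case: a.2 => /and4P[/eqP-> /eqP-> /eqP-> /eqP->].
case: a.2 => /= -[E F].
  exists (color_before c (head_of a), color_after c (tail_of a)).
  by rewrite E F !eqxx.
exists (color_after c (head_of a), color_before c (tail_of a)).
by rewrite E F !eqxx.
Qed.

Lemma is_coloringP D (c : gap_colors X D) :
  reflect (last (thead c) (behead c) = thead c /\ compatible (gap_passages c))
          (is_coloring c).
Proof.
have -> : is_coloring c = (last (thead c) (behead c) == thead c) &&
    all (fun a => [exists xy, labeled c a xy]) (arrows D).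
  by rewrite /is_coloring [X in last _ (tval X) == _]/= {1}gap_colorsE.
apply: (iffP andP) => [[/eqP cl /allP lab]|[cl cp]]; split=> //.
- move=> a h t; rewrite !mem_gap_passages => /andP[ha /eqP->] /andP[_ /eqP->].
  by apply/crossing_labeled/lab; rewrite mem_arrows.
- exact/eqP.
- apply/allP=> a aD; apply/crossing_labeled.
  by apply: cp; rewrite mem_gap_passages -mem_arrows aD eqxx.
Qed.

End Colorings.

(** * Replacing arcs of a diagram *)

Notation source_word u l := (weave u [seq (i.1.1, i.2) | i <- l]).
Notation target_word u l := (weave u [seq (i.1.2, i.2) | i <- l]).

Section Weaving.
Variable X : finBiquandleType.

Definition swap_arc (i : word * word * word) : word * word * word :=
  (swap_pair i.1, i.2).

(** A pair (b, b') of a move, with a coloring of b: the color entering it and the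
    colors after each of its endpoints. *)
Definition strand : Type := (word * word) * (X * seq X).
Definition strand_passages (i : strand) := passages i.2.1 i.1.1 i.2.2.

Definition fits (i : strand) := size i.2.2 = size i.1.1.

Definition all_passages (L : seq strand) := flatten (map strand_passages L).

(** Carrying out the move on the arc, the new colors being given by f.  As f is
    indexed by the new word, it does not depend on the order of the arcs. *)
Definition recolor (f : word -> seq X) (i : strand) : strand :=
  (swap_pair i.1, (i.2.1, f i.1.2)).

Definition same_ends (f : word -> seq X) (i : strand) :=
  size (f i.1.2) = size i.1.2 /\ last i.2.1 (f i.1.2) = last i.2.1 i.2.2.

(** Two colorings of the same arc with the same entering color. *)
Definition twin_strands : Type := (word * word) * (X * (seq X * seq X)).
Definition left_strand (i : twin_strands) : strand := (i.1, (i.2.1, i.2.2.1)).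
Definition right_strand (i : twin_strands) : strand := (i.1, (i.2.1, i.2.2.2)).

Implicit Types (x y : X) (t : seq X) (u w : word) (l : seq (word * word * word)).

(** The colors x :: t of a woven word are cut at the ends of the arcs: [strands]
    collects the pieces in the arcs, [outer_passages] the passages outside, and
    [recolor_weave] replaces the former. *)
Fixpoint strands x t u l : seq strand :=
  if l is (b, b', v) :: l' then
    let y := last x (take (size u) t) in
    let t1 := drop (size u) t in
    let tb := take (size b) t1 in
    ((b, b'), (y, tb)) :: strands (last y tb) (drop (size b) t1) v l'
  else [::].

Fixpoint outer_passages x t u l : seq (endpoint * (X * X)) :=
  if l is (b, b', v) :: l' then
    let y := last x (take (size u) t) in
    let t1 := drop (size u) t in
    passages x u (take (size u) t) ++
      outer_passages (last y (take (size b) t1)) (drop (size b) t1) v l'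
  else passages x u t.

Fixpoint recolor_weave f t u l : seq X :=
  if l is (b, b', v) :: l' then
    take (size u) t ++ f b' ++
      recolor_weave f (drop (size b) (drop (size u) t)) v l'
  else t.

Lemma size_split_weave t u b b' v l :
    size t = size (source_word u ((b, b', v) :: l)) ->
  exists tu tb t', [/\ t = tu ++ tb ++ t', size tu = size u, size tb = size b
    & size t' = size (source_word v l)].
Proof.
rewrite /= !size_cat => /size_split[tu [t1 [-> stu /size_split[tb [t' [-> stb st']]]]]].
by exists tu, tb, t'.
Qed.

Lemma passages_weave x t u l : size t = size (source_word u l) ->
  perm_eq (passages x (source_word u l) t)
          (all_passages (strands x t u l) ++ outer_passages x t u l).
Proof.
elim: l x t u => [|[[b b'] v] l IH] x t u /= szt; first exact: perm_refl.
have := size_split_weave (szt : size t = size (source_word u ((b, b', v) :: l))).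
case=> [tu [tb [t' [-> stu stb st']]]].
rewrite -stu -stb !(take_size_cat _ erefl, drop_size_cat _ erefl).
rewrite !passages_cat // /all_passages /= /strand_passages /=.
apply/permP=> p; rewrite !count_cat (permP (IH _ _ _ st')) count_cat.
by rewrite addnCA -[RHS]addnA; congr (_ + _); rewrite addnCA.
Qed.

Lemma map_strands x t u l : map fst (strands x t u l) = map fst l.
Proof. by elim: l x t u => [|[[b b'] v] l IH] x t u //=; rewrite IH. Qed.

Lemma strands_fit x t u l : size t = size (source_word u l) ->
  {in strands x t u l, forall i, fits i}.
Proof.
elim: l x t u => [|[[b b'] v] l IH] x t u //= szt.
have := size_split_weave (szt : size t = size (source_word u ((b, b', v) :: l))).
case=> [tu [tb [t' [-> stu stb st']]]].
rewrite -stu -stb !(take_size_cat _ erefl, drop_size_cat _ erefl) => i.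
rewrite inE => /predU1P[-> //|].
exact: IH.
Qed.

Lemma source_swap u l : source_word u (map swap_arc l) = target_word u l.
Proof. by rewrite -map_comp. Qed.

Lemma swap_arcK : involutive swap_arc.
Proof. by case=> [[]]. Qed.

Lemma map_fst_swap (l : seq (word * word * word)) :
  map fst (map swap_arc l) = map swap_pair (map fst l).
Proof. by rewrite -!map_comp; apply: eq_map => -[[]]. Qed.

(** As the new arcs end with the old colors, the cuts of the recolored word have
    the same entering colors as before. *)
Lemma recolor_weaveP f x t u l (t' := recolor_weave f t u l) :
    size t = size (source_word u l) ->
    {in strands x t u l, forall i, same_ends f i} ->
  [/\ size t' = size (target_word u l), last x t' = last x t,
      outer_passages x t' u (map swap_arc l) = outer_passages x t u l,
      strands x t' u (map swap_arc l) = map (recolor f) (strands x t u l)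
    & agree_outside (x :: t) (x :: t') u l].
Proof.
rewrite {}/t'; elim: l x t u => [|[[b b'] v] l IH] x t u //= szt.
have := size_split_weave (szt : size t = size (source_word u ((b, b', v) :: l))).
case=> [tu [tb [t' [-> stu stb st']]]].
rewrite -stu -stb !(take_size_cat _ erefl, drop_size_cat _ erefl) => same_f.
have [szf endf] := same_f _ (mem_head _ _); rewrite /= in szf endf.
have /(IH (last (last x tu) tb) _ _ st')[sz la out str agr] :
    {in strands (last (last x tu) tb) t' v l, forall i, same_ends f i}.
  by move=> i iin; apply: same_f; rewrite inE iin orbT.
split.
- by rewrite !size_cat szf sz stu.
- by rewrite !last_cat endf la.
- by rewrite ?(take_size_cat, drop_size_cat) // endf out.
- by rewrite ?(take_size_cat, drop_size_cat) // endf str.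
rewrite ?(take_size_cat, drop_size_cat) // -szf.
rewrite -!size_cat !catA !drop_cons_last !last_cat endf; split=> //.
Qed.

Lemma agree_outside_sym (c c' : seq X) u l :
  agree_outside c c' u l -> agree_outside c' c u (map swap_arc l).
Proof.
elim: l c c' u => [|[[b b'] v] l IH] c c' u /= [-> ag]; first by [].
by split=> //; apply: IH.
Qed.

Lemma agree_outside_map (phi : X -> X) (c c' : seq X) u l :
  agree_outside c c' u l -> agree_outside (map phi c) (map phi c') u l.
Proof.
elim: l c c' u => [|[[b b'] v] l IH] c c' u /= [e ag].
  by rewrite -!map_take e.
by rewrite -!map_take -!map_drop e; split=> //; apply: IH.
Qed.

(** Extensions of the same c have the same entering colors on every new arc, and
    can differ only inside the arcs. *)
Lemma agree_strands (c : seq X) x1 t1 x2 t2 u l :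
    size t1 = size (target_word u l) -> size t2 = size (target_word u l) ->
    agree_outside c (x1 :: t1) u l -> agree_outside c (x2 :: t2) u l ->
  exists M : seq twin_strands,
    [/\ strands x1 t1 u (map swap_arc l) = map left_strand M,
        strands x2 t2 u (map swap_arc l) = map right_strand M
      & {in M, forall i, i.2.2.1 = i.2.2.2} -> x1 :: t1 = x2 :: t2].
Proof.
rewrite -source_swap.
elim: l c x1 t1 x2 t2 u => [|[[b b'] v] l IH] c x1 t1 x2 t2 u sz1 sz2.
  rewrite /= in sz1 sz2 *.
  move=> [-> _] [] [-> e] _; exists [::]; split=> // _.
  by move: e; rewrite -{1}sz1 -sz2 !take_size => ->.
case/size_split_weave: sz1 => [tu1 [tb1 [t1' [-> su1 sb1 st1]]]].
case/size_split_weave: sz2 => [tu2 [tb2 [t2' [-> su2 sb2 st2]]]].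
move=> /= [-> ag1] [eu ag2].
have {eu}[? ?] : x1 = x2 /\ tu1 = tu2.
  case: eu => -> e; split=> //; move: e.
  by rewrite -{1}su1 -su2 !take_size_cat.
subst x2 tu2; rewrite /= in sb1 sb2.
have dropE tb t' : size tb = size b' ->
    drop (size u + size b') (x1 :: tu1 ++ tb ++ t') = last (last x1 tu1) tb :: t'.
  by move=> <-; rewrite -su1 -size_cat catA drop_cons_last last_cat.
rewrite dropE // in ag1; rewrite dropE // in ag2.
have {}st1 : size t1' = size (source_word v (map swap_arc l)) by [].
have {}st2 : size t2' = size (source_word v (map swap_arc l)) by [].
have [M [E1 E2 eqM]] := IH _ _ _ _ _ _ st1 st2 ag1 ag2.
exists (((b', b), (last x1 tu1, (tb1, tb2))) :: M).
rewrite -su1 -{1 2 3}sb1 !(take_size_cat _ erefl, drop_size_cat _ erefl).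
rewrite -sb2 !(take_size_cat _ erefl, drop_size_cat _ erefl) E1 E2.
split=> // eqs; have /= -> := eqs _ (mem_head _ _).
have /eqM[_ -> //] : {in M, forall i, i.2.2.1 = i.2.2.2}.
by move=> i iM; apply: eqs; rewrite inE iM orbT.
Qed.

End Weaving.

Arguments left_strand {X} i.
Arguments right_strand {X} i.

(** * Rigidity of the local moves *)

Section LocalMoves.
Variable X : finBiquandleType.
Local Notation strand := (strand X).
Local Notation twin_strands := (twin_strands X).
Implicit Types (bs : seq (word * word)) (L : seq strand).

Definition extends bs := forall L, map fst L = bs ->
  {in L, forall i, fits i} -> compatible (all_passages L) ->
  exists f, {in L, forall i, same_ends f i} /\
            compatible (all_passages (map (recolor f) L)).

Definition determined bs := forall M : seq twin_strands, map fst M = bs ->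
  {in M, forall i, fits (left_strand i) /\ fits (right_strand i)} ->
  compatible (all_passages (map left_strand M)) ->
  compatible (all_passages (map right_strand M)) ->
  {in M, forall i, i.2.2.1 = i.2.2.2}.

(** One direction of a move; the other one is [rigid (map swap_pair bs)]. *)
Definition rigid bs :=
  [/\ extends bs, determined bs & closed_word (flatten (unzip1 bs))].

Lemma compatible_perm L L' :
  perm_eq L L' -> compatible (all_passages L) -> compatible (all_passages L').
Proof.
move=> pL; apply: compatible_sub => i.
by rewrite /all_passages (perm_mem (perm_flatten (perm_map _ pL))).
Qed.

(** All conditions concern the set of strands, so the order of the arcs is
    irrelevant. *)
Lemma rigid_perm bs bs0 : perm_eq bs bs0 -> rigid bs0 -> rigid bs.
Proof.
move=> pbs [ext det clo]; split.
- move=> L EL fit cp; move: pbs; rewrite -EL => /perm_map_lift[L0 pL /ext ext0].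
  have /ext0[|f [same cpf]] : {in L0, forall i, fits i}.
    by move=> i; rewrite -(perm_mem pL); apply: fit.
    exact: compatible_perm cp.
  exists f; split; first by move=> i; rewrite (perm_mem pL); apply: same.
  by apply: compatible_perm cpf; rewrite perm_map // perm_sym.
- move=> L EL fit cp1 cp2; move: pbs; rewrite -EL => /perm_map_lift[L0 pL /det det0].
  move=> i; rewrite (perm_mem pL); apply: det0.
  + by move=> j; rewrite -(perm_mem pL); apply: fit.
  + by apply: compatible_perm cp1; rewrite perm_map.
  + by apply: compatible_perm cp2; rewrite perm_map.
- have pw : perm_eq (flatten (unzip1 bs)) (flatten (unzip1 bs0)).
    by rewrite perm_flatten // perm_map.
  by move=> e; rewrite !(perm_mem pw); apply: clo.
Qed.

Lemma rigid_kink_add a e : rigid [:: ([::], [:: (a, e); (a, ~~ e)])].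
Proof.
split=> //.
- case=> [|[b [y t]] [|]] //= [->] /(_ _ (mem_head _ _))/size0nil /= -> _.
  have [m K] := kink_ex a.2 e y; exists (fun=> [:: m; y]); split.
    by move=> i; rewrite inE => /eqP->.
  rewrite /all_passages /= /strand_passages /=.
  move=> a' h t'; rewrite !inE !xpair_eqE.
  by case: e K => /=; rewrite ?andbF ?orbF => K /andP[/andP[/eqP-> _] /eqP->] 
    /andP[_ /eqP->].
- case=> [|[b [y [t1 t2]]] [|]] //= [->] fit _ _ i; rewrite inE => /eqP->.
  by case: (fit _ (mem_head _ _)) => /size0nil /= -> /size0nil /= ->.
Qed.

Lemma rigid_kink_remove a e : rigid [:: ([:: (a, e); (a, ~~ e)], [::])].
Proof.
have K y m z : compatible (all_passages
    [:: ([:: (a, e); (a, ~~ e)], Nil endpoint, (y, [:: m; z]))]) ->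
    kink a.2 e y m z.
  rewrite /all_passages /= /strand_passages /= => cp.
  case: (e) cp => cp; apply: cp; by rewrite !inE ?eqxx ?orbT.
split=> //.
- case=> [|[b [y t]] [|]] //= [->] /(_ _ (mem_head _ _)).
  case: t => [|m [|z []]] // _ /K k.
  exists (fun=> [::]); split=> // i; rewrite inE => /eqP->; split=> //=.
  by have [_ ->] := kink_uniq k k.
- case=> [|[b [y [t1 t2]]] [|]] //= [->] /(_ _ (mem_head _ _)) [].
  case: t1 => [|m [|z []]] //; case: t2 => [|m' [|z' []]] // _ _.
  move=> /K k /K k' i; rewrite inE => /eqP-> /=.
  by have [-> ->] := kink_uniq k k'; have [_ ->] := kink_uniq k' k'.
- move=> f; rewrite /= !inE => /orP[]/eqP-> /=; rewrite ?negbK eqxx ?orbT //.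
Qed.

Definition two_word (b : bool) (e e' : endpoint) : word :=
  if b then [:: e; e'] else [:: e'; e].

Section Poke.
Variables (p n : arrow) (oh ot : bool).
Hypotheses (pP : p.2) (nN : ~~ n.2).

Let ts := two_word ot (tail_of p) (tail_of n).
Let hs := two_word oh (head_of p) (head_of n).

Lemma compatible_pokeP (r m r' q k q' : X) (b1 b2 : word) :
  compatible (all_passages [:: ((ts, b1), (q, [:: k; q']));
                               ((hs, b2), (r, [:: m; r']))]) <->
  poke oh ot r m r' q k q'.
Proof.
have pn : (p == n) = false by apply/eqP=> e; move: nN; rewrite -e pP.
have np : (n == p) = false by rewrite eq_sym.
rewrite /all_passages /= /strand_passages /= /poke /ts /hs /two_word; split.
  move=> cp; split.
    have := cp p (passage oh r m r') (passage ot q k q').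
    by rewrite /crossing pP; apply; case: oh ot => [] [];
      rewrite !inE eqxx ?orbT.
  have := cp n (passage (~~ oh) r m r') (passage (~~ ot) q k q').
  rewrite /crossing (negbTE nN) => H.
  have {H} : positive_crossing _ _ := H _ _.
  by case: oh ot => [] [] /= H; apply: H; rewrite !inE eqxx ?orbT.
move=> [P N] a h t.
set ps := (X in _ \in X -> _).
have -> : ((head_of a, h) \in ps) =
    ((a == p) && (h == passage oh r m r')) ||
    ((a == n) && (h == passage (~~ oh) r m r')).
  by rewrite /ps; case: oh ot => [] [] /=;
    rewrite !inE !xpair_eqE /= ?andbF ?andbT /= 1?orbC.
have -> : ((tail_of a, t) \in ps) =
    ((a == p) && (t == passage ot q k q')) ||
    ((a == n) && (t == passage (~~ ot) q k q')).
  by rewrite /ps; case: oh ot => [] [] /=;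
    rewrite !inE !xpair_eqE /= ?andbF ?andbT ?orbF /= 1?orbC.
case/orP=> /andP[/eqP-> /eqP->]; rewrite ?pn ?np eqxx /= ?orbF => /eqP->.
  by rewrite /crossing pP.
by rewrite /crossing (negbTE nN); case: oh ot N => [] [].
Qed.

Lemma rigid_poke_add : rigid [:: ([::], ts); ([::], hs)].
Proof.
split=> //.
- case=> [|[b [q t]] [|[b' [r t']] [|]]] //= [-> ->] fit _.
  have := fit _ (mem_head _ _) => /size0nil /= ->.
  have := fit _ (mem_last _ _) => /size0nil /= ->.
  have [m [k K]] := poke_ex oh ot r q.
  (* The two new arcs are told apart by the kind of their endpoints. *)
  exists (fun w => if all snd w then [:: m; r] else [:: k; q]).
  have hsE : all snd hs by rewrite /hs; case: oh.
  have tsE : all snd ts = false by rewrite /ts; case: ot.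
  split.
    move=> i; rewrite !inE => /orP[] /eqP->; rewrite /same_ends /= ?hsE ?tsE.
      by rewrite /ts; case: ot.
    by rewrite /hs; case: oh.
  by rewrite /recolor /= hsE tsE; apply/compatible_pokeP.
- case=> [|[b [q [t1 t2]]] [|[b' [r [t1' t2']]] [|]]] //= [-> ->] fit _ _ i.
  case: (fit _ (mem_head _ _)) => /size0nil /= e1 /size0nil /= e2.
  case: (fit _ (mem_last _ _)) => /size0nil /= e3 /size0nil /= e4.
  by rewrite !inE => /orP[] /eqP->; rewrite /= ?e1 ?e2 ?e3 ?e4.
Qed.

Lemma rigid_poke_remove : rigid [:: (ts, [::]); (hs, [::])].
Proof.
have sts : size ts = 2 by rewrite /ts; case: ot.
have shs : size hs = 2 by rewrite /hs; case: oh.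
split=> //.
- case=> [|[b [q t]] [|[b' [r t']] [|]]] //= [-> ->] fit.
  have := fit _ (mem_head _ _); have := fit _ (mem_last _ _).
  rewrite /fits /= sts shs.
  case: t' {fit} => [|m [|r' []]] // _; case: t => [|k [|q' []]] // _.
  move=> /compatible_pokeP /poke_closed[-> ->]; exists (fun=> [::]); split=> //.
  by move=> i; rewrite !inE => /orP[] /eqP->.
- case=> [|[b [q [t1 t2]]] [|[b' [r [t1' t2']]] [|]]] //= [-> ->] fit.
  case: (fit _ (mem_head _ _)); case: (fit _ (mem_last _ _)).
  rewrite /fits /= sts shs {fit}.
  case: t1' => [|m [|r' []]] // _; case: t2' => [|m1 [|r1 []]] // _.
  case: t1 => [|k [|q' []]] // _; case: t2 => [|k1 [|q1 []]] // _.
  move=> /compatible_pokeP K /compatible_pokeP K1 i.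
  have [-> ->] := poke_closed K; have [-> ->] := poke_closed K1.
  have [-> ->] := poke_uniq K K1.
  by rewrite !inE => /orP[] /eqP->.
- move=> e; rewrite /= /ts /hs /two_word.
  by case: oh ot => [] []; rewrite !inE => /or4P[]/eqP-> /=; rewrite !eqxx ?orbT.
Qed.

End Poke.

Section Triangle.
Variables p q r : arrow.
Hypotheses (pP : p.2) (qP : q.2) (rP : r.2).
Hypotheses (pq : p != q) (pr : p != r) (qr : q != r).

Let arc1 b := two_word b (head_of p) (head_of q).
Let arc2 b := two_word b (tail_of p) (head_of r).
Let arc3 b := two_word b (tail_of q) (tail_of r).

Lemma compatible_triangleP b (A m1 A' B m2 B' C m3 C' : X)
    (b1 b2 b3 : word) :
  compatible (all_passages [:: ((arc1 b, b1), (A, [:: m1; A']));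
      ((arc2 b, b2), (B, [:: m2; B'])); ((arc3 b, b3), (C, [:: m3; C']))]) <->
  triangle b A m1 A' B m2 B' C m3 C'.
Proof.
have neqs : ((p == q = false) * (q == p = false) * (p == r = false) *
             (r == p = false) * (q == r = false) * (r == q = false)).
  by rewrite (eq_sym q p) (eq_sym r p) (eq_sym r q)
             !(negbTE pq, negbTE pr, negbTE qr).
rewrite /all_passages /= /strand_passages /=; split.
  move=> cp; split.
  - have := cp p (passage b A m1 A') (passage b B m2 B').
    rewrite /crossing pP; apply; case: (b);
      by rewrite !inE eqxx ?orbT.
  - have := cp q (passage (~~ b) A m1 A') (passage b C m3 C').
    rewrite /crossing qP; apply; case: (b);
      by rewrite !inE eqxx ?orbT.
  - have := cp r (passage (~~ b) B m2 B') (passage (~~ b) C m3 C').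
    rewrite /crossing rP; apply; case: (b);
      by rewrite !inE eqxx ?orbT.
case: b => -[/= P Q R] a h t;
  rewrite !inE !xpair_eqE /= ?andbF ?andbT ?orbF /=;
  by case/or3P=> /andP[/eqP-> /eqP->]; rewrite !neqs eqxx /= ?orbF => /eqP->;
    rewrite /crossing ?pP ?qP ?rP.
Qed.

Lemma rigid_triangle b :
  rigid [:: (arc1 b, arc1 (~~ b)); (arc2 b, arc2 (~~ b)); (arc3 b, arc3 (~~ b))].
Proof.
have two2 b' e e' : size (two_word b' e e') = 2 by case: b'.
split.
- case=> [|[b1 [A t1]] [|[b2 [B t2]] [|[b3 [C t3]] [|]]]] //= [-> -> ->] fit.
  move/in_seq3: fit; rewrite /fits /= !two2 => -[s1 s2 s3].
  case: t1 s1 => [|m1 [|A1 []]] //; case: t2 s2 => [|m2 [|B1 []]] // _ _.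
  case: t3 s3 => [|m3 [|C1 []]] // _ /compatible_triangleP T.
  have [n1 [A2 [n2 [B2 [n3 [C2 T']]]]]] := triangle_ex (~~ b) A B C.
  have [? ? ?] := triangle_ends T T'; subst A2 B2 C2.
  (* Two heads lie on the first arc, one on the second, none on the third. *)
  pose f (w : word) := if all snd w then [:: n1; A1]
                       else if has snd w then [:: n2; B1] else [:: n3; C1].
  have [f1 f2 f3] : [/\ f (arc1 (~~ b)) = [:: n1; A1],
      f (arc2 (~~ b)) = [:: n2; B1] & f (arc3 (~~ b)) = [:: n3; C1]].
    by case: (b).
  exists f; split; last by rewrite /= /recolor f1 f2 f3; apply/compatible_triangleP.
  move=> i; rewrite !inE => /or3P[]/eqP->; rewrite /same_ends /=.
  - by rewrite f1 two2.
  - by rewrite f2 two2.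
  - by rewrite f3 two2.
- case=> [|[b1 [A [t1 s1]]] [|[b2 [B [t2 s2]]] [|[b3 [C [t3 s3]]] [|]]]] //=.
  move=> [-> -> ->] fit.
  move/in_seq3: fit; rewrite /fits /= !two2 => -[[u1 v1] [u2 v2] [u3 v3]].
  case: t1 u1 => [|m1 [|A1 []]] //; case: t2 u2 => [|m2 [|B1 []]] // _ _.
  case: t3 u3 => [|m3 [|C1 []]] //; case: s1 v1 => [|n1 [|A2 []]] // _ _.
  case: s2 v2 => [|n2 [|B2 []]] //; case: s3 v3 => [|n3 [|C2 []]] // _ _.
  move=> /compatible_triangleP T /compatible_triangleP T' i.
  have [-> -> ->] := triangle_uniq T T'.
  by rewrite !inE => /or3P[]/eqP->.
- move=> e; rewrite /= /arc1 /arc2 /arc3 /two_word.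
  case: (b); rewrite !inE => /or3P[/eqP->|/eqP->|/or4P[]/eqP->] /=;
    by rewrite !eqxx ?orbT.
Qed.

End Triangle.

(** Uniqueness of the endpoints makes the three arrows of move III distinct. *)
Lemma local_move_rigid bs :
    local_move bs -> uniq (flatten (unzip1 bs)) ->
  rigid bs /\ rigid (map swap_pair bs).
Proof.
case=> [a e|a b ts hs {}bs ab pts phs pbs|p q r {}bs pP qP rP pbs] ubs.
- by split; [apply: rigid_kink_add | apply: rigid_kink_remove].
- have [c [d [oh [ot [cP dN tsE hsE]]]]] : exists (c d : arrow) (oh ot : bool), [/\ c.2, ~~ d.2,
      ts = two_word ot (tail_of c) (tail_of d)
    & hs = two_word oh (head_of c) (head_of d)].
    have [oh hsE] := perm_pair phs; have [ot tsE] := perm_pair pts.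
    case aP : a.2 ab => bN; first by exists a, b, oh, ot; split=> //; case: b.2 bN.
    exists b, a, (~~ oh), (~~ ot); rewrite /two_word aP hsE tsE !if_neg.
    by split=> //; case: b.2 bN.
  rewrite tsE hsE in pbs; split.
    by apply: rigid_perm pbs _; apply: rigid_poke_add.
  by apply: rigid_perm (perm_map _ pbs) _; apply: rigid_poke_remove.
have := perm_uniq (perm_flatten (perm_map fst pbs)); rewrite -/(unzip1 _) ubs.
move=> /esym; rewrite /= !inE !xpair_eqE /= !andbT ?andbF ?orbF /= negb_or.
case/and4P=> /andP[pq pr] qr _ _.
have T b := rigid_triangle pP qP rP pq pr qr b.
split; first exact: rigid_perm pbs (T true).
exact: rigid_perm (perm_map _ pbs) (T false).
Qed.

End LocalMoves.

(** * Colorings of diagrams related by a Reidemeister move *)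

Section ColoringMoves.
Variable X : finBiquandleType.
Implicit Types (D : gauss_diagram) (L : seq (strand X)).

Lemma unzip1_all_passages L : {in L, forall i, fits i} ->
  unzip1 (all_passages L) = flatten (unzip1 (map fst L)).
Proof.
rewrite /all_passages; elim: L => [|i L IH] //= fit.
rewrite /unzip1 map_cat -/(unzip1 _) -/(unzip1 _) IH => [|j jL].
  by rewrite unzip1_passages //; apply: fit; rewrite mem_head.
by apply: fit; rewrite inE jL orbT.
Qed.

Section OneDiagram.
Variables (D : gauss_diagram) (u : word) (l : seq (word * word * word)).
Hypothesis DE : code D = source_word u l.

Lemma size_source (c : gap_colors X D) : size (behead c) = size (source_word u l).
Proof. by rewrite size_behead_colors DE. Qed.

Lemma gap_passages_weave (c : gap_colors X D) (x := thead c) (t := behead c) :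
  perm_eq (gap_passages c)
          (all_passages (strands x t u l) ++ outer_passages x t u l).
Proof. by have := passages_weave x (size_source c); rewrite -DE. Qed.

Lemma coloring_strands (c : gap_colors X D) (x := thead c) (t := behead c) :
    is_coloring c ->
  compatible (all_passages (strands x t u l)) /\
  compatible (outer_passages x t u l).
Proof.
move=> /is_coloringP[_ cp].
by split; apply: compatible_sub cp => i;
  rewrite (perm_mem (gap_passages_weave c)) mem_cat => ->; rewrite ?orbT.
Qed.

Lemma strands_coloring (c : gap_colors X D) (x := thead c) (t := behead c) :
    closed_word (flatten (unzip1 (map fst l))) -> last x t = x ->
    compatible (all_passages (strands x t u l)) ->
    compatible (outer_passages x t u l) ->
  is_coloring c.
Proof.
move=> clo closed cp1 cp2; apply/is_coloringP; split=> //.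
have pm := gap_passages_weave c.
suff: compatible (all_passages (strands x t u l) ++ outer_passages x t u l).
  by apply: compatible_sub => i; rewrite (perm_mem pm).
apply: compatible_cat => //.
  rewrite -(perm_uniq (perm_map fst pm)) -/(unzip1 _) unzip1_passages.
    by case/andP: (codeP D).
  exact: size_behead_colors.
rewrite unzip1_all_passages ?map_strands //; apply: strands_fit; exact: size_source.
Qed.

End OneDiagram.

Variables (D D' : gauss_diagram) (u : word) (l : seq (word * word * word)).
Hypotheses (DE : code D = source_word u l) (D'E : code D' = target_word u l).

Lemma extend_coloring (c : gap_colors X D) :
    rigid X (map fst l) -> rigid X (map swap_pair (map fst l)) ->
    is_coloring c ->
  exists2 c' : gap_colors X D', is_coloring c' & agree_outside c c' u l.
Proof.
case=> ext _ _ [_ _ clo] col; have [cp_in cp_out] := coloring_strands DE col.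
have szt := size_source DE c.
have [|f [same cp_f]] := ext _ (map_strands _ _ _ _) _ cp_in.
  exact: strands_fit.
have [sz la out str agr] := recolor_weaveP szt same.
have szc : size (thead c :: recolor_weave f (behead c) u l) == (size (code D')).+1.
  by rewrite /= sz D'E.
pose c' : gap_colors X D' := Tuple szc.
exists c'; last by rewrite [X in agree_outside X]gap_colorsE.
have D'E' : code D' = source_word u (map swap_arc l) by rewrite source_swap.
apply: (strands_coloring D'E').
- by rewrite map_fst_swap.
- by rewrite [LHS]la; case/is_coloringP: col.
- by rewrite [strands _ _ _ _]str.
- by rewrite [outer_passages _ _ _ _]out.
Qed.

Lemma extension_uniq (c : gap_colors X D) (c1 c2 : gap_colors X D') :
    rigid X (map swap_pair (map fst l)) -> is_coloring c1 -> is_coloring c2 ->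
    agree_outside c c1 u l -> agree_outside c c2 u l ->
  c1 = c2.
Proof.
case=> _ det _ col1 col2.
rewrite [X in agree_outside _ X]gap_colorsE [X in _ -> agree_outside _ X _ _ -> _]gap_colorsE.
move=> ag1 ag2; apply: val_inj; rewrite /= gap_colorsE [RHS]gap_colorsE.
have D'E' : code D' = source_word u (map swap_arc l) by rewrite source_swap.
have sz1 := size_source D'E' c1; have sz2 := size_source D'E' c2.
have [M [E1 E2]] := agree_strands (etrans sz1 (congr1 size (source_swap _ _)))
   (etrans sz2 (congr1 size (source_swap _ _))) ag1 ag2.
apply; apply: det.
- have := map_strands (thead c1) (behead c1) u (map swap_arc l).
  by rewrite E1 map_fst_swap => <-; rewrite -map_comp.
- move=> i iM; split.
    by apply: (strands_fit sz1 (x := thead c1)); rewrite E1; apply/mapP; exists i.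
  by apply: (strands_fit sz2 (x := thead c2)); rewrite E2; apply/mapP; exists i.
- by have [] := coloring_strands D'E' col1; rewrite E1.
- by have [] := coloring_strands D'E' col2; rewrite E2.
Qed.

End ColoringMoves.

Section Matching.
Variables (X : finBiquandleType) (A : zmodType) (W : (X * X) * (X * X) -> A).
Implicit Types D : gauss_diagram.

Definition coloring_match D D' := exists fV : coloring X D -> coloring X D',
  [/\ bijective fV,
      forall phi f, coloring_endo phi (fV f) = fV (coloring_endo phi f)
    & forall f, Sigma W (sval (fV f)) = Sigma W (sval f)].

Lemma coloring_match_refl D : coloring_match D D.
Proof. by exists id; split=> //; exists id. Qed.

Lemma coloring_match_sym D D' : coloring_match D D' -> coloring_match D' D.
Proof.
case=> f [[g fK gK] fE fS]; exists g; split; first by exists f.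
  by move=> phi c; rewrite -[c in RHS]gK fE fK.
by move=> c; rewrite -fS gK.
Qed.

Lemma coloring_match_trans D1 D2 D3 :
  coloring_match D1 D2 -> coloring_match D2 D3 -> coloring_match D1 D3.
Proof.
case=> f [bf fE fS] [g [bg gE gS]]; exists (g \o f); split.
- exact: bij_comp.
- by move=> phi c /=; rewrite gE fE.
- by move=> c /=; rewrite gS fS.
Qed.

(** A correspondence of colorings that is compatible with endomorphisms gives a
    bijection that commutes with them, because values are unique. *)
Lemma coloring_match_rel D D' (R : gap_colors X D -> gap_colors X D' -> Prop) :
    (forall c, is_coloring c -> exists2 c', is_coloring c' & R c c') ->
    (forall c', is_coloring c' -> exists2 c, is_coloring c & R c c') ->
    (forall c c1 c2, is_coloring c -> is_coloring c1 -> is_coloring c2 ->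
      R c c1 -> R c c2 -> c1 = c2) ->
    (forall c1 c2 c', is_coloring c1 -> is_coloring c2 -> is_coloring c' ->
      R c1 c' -> R c2 c' -> c1 = c2) ->
    (forall phi c c', R c c' -> R (endo_colors phi c) (endo_colors phi c')) ->
    (forall c c', is_coloring c -> is_coloring c' -> R c c' ->
      Sigma W c' = Sigma W c) ->
  coloring_match D D'.
Proof.
move=> totl totr funl funr endo sig.
have /fin_all_exists[f fR] : forall c : {c : gap_colors X D | is_coloring c},
    exists c' : coloring X D', R (sval c) (sval c').
  by move=> [c col]; have [c' col' ?] := totl c col; exists (exist _ c' col').
have /fin_all_exists[g gR] : forall c : {c : gap_colors X D' | is_coloring c},
    exists c' : coloring X D, R (sval c') (sval c).
  by move=> [c col]; have [c' col' ?] := totr c col; exists (exist _ c' col').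
exists f; split.
- exists g => c; apply: val_inj.
    exact: (funr _ _ _) (svalP (g (f c))) (svalP c) (svalP (f c)) (gR (f c)) (fR c).
  exact: (funl _ _ _) (svalP (g c)) (svalP (f (g c))) (svalP c) (fR (g c)) (gR c).
- move=> phi c; apply: val_inj.
  exact: (funl _ _ _) (svalP (coloring_endo phi c)) (svalP (coloring_endo phi (f c)))
    (svalP (f (coloring_endo phi c))) (endo _ _ _ (fR c)) (fR (coloring_endo phi c)).
- by move=> c; apply: (sig _ _) (svalP c) (svalP (f c)) (fR c).
Qed.

Lemma subseq_arcs (u : word) (l : seq (word * word * word)) :
  subseq (flatten (unzip1 (map fst l))) (weave u [seq (i.1.1, i.2) | i <- l]).
Proof.
elim: l u => [|[[b b'] v] l IH] u /=; first exact: sub0seq.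
by apply: subseq_trans (suffix_subseq u _); rewrite cat_subseq.
Qed.

Lemma reidemeister_match (hW : arrow_weight W) D D' :
  reidemeister_move D D' -> coloring_match D D'.
Proof.
case=> u [l [mv DE D'E]].
have cols c c' : is_coloring c -> is_coloring c' -> agree_outside c c' u l ->
    colored_move (c : gap_colors X D) (c' : gap_colors X D').
  by move=> ? ? ?; split=> //; exists u, l.
have [rig rig'] : rigid X (map fst l) /\ rigid X (map swap_pair (map fst l)).
  apply: local_move_rigid => //; apply: subseq_uniq (subseq_arcs u l) _.
  by rewrite -DE; case/andP: (codeP D).
have DE' : code D = weave u [seq (i.1.2, i.2) | i <- map swap_arc l].
  by rewrite -source_swap (mapK swap_arcK).
have D'E' : code D' = weave u [seq (i.1.1, i.2) | i <- map swap_arc l].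
  by rewrite source_swap.
have rigs : rigid X (map fst (map swap_arc l)) by rewrite map_fst_swap.
have rigs' : rigid X (map swap_pair (map fst (map swap_arc l))).
  by rewrite -map_fst_swap (mapK swap_arcK).
pose R (c : gap_colors X D) (c' : gap_colors X D') := agree_outside c c' u l.
apply: (@coloring_match_rel _ _ R).
- by move=> c; apply: extend_coloring.
- move=> c' col'; have [c col ag] := extend_coloring D'E' DE' rigs rigs' col'.
  by exists c => //; have := agree_outside_sym ag; rewrite (mapK swap_arcK).
- by move=> c c1 c2 _ col1 col2; apply: extension_uniq.
- move=> c1 c2 c' col1 col2 _ /agree_outside_sym ag1 /agree_outside_sym ag2.
  exact: extension_uniq ag1 ag2.
- by move=> phi c c'; apply: agree_outside_map.
- by move=> c c' col col' ag; rewrite (hW _ _ _ _ (cols _ _ col col' ag)).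
Qed.

(** * Change of base point and of arrow names *)

Section Homeo.
Variables (D D' : gauss_diagram) (s : arrow -> arrow) (k : nat).
Hypotheses (s_inj : {in arrows D &, injective s}).
Hypotheses (s_sign : {in arrows D, forall a, (s a).2 = a.2}).

Let rename (e : endpoint) : endpoint := (s e.1, e.2).
Hypothesis D'E : code D' = rot k [seq rename e | e <- code D].

Lemma arrow_of_endpoint e : e \in code D -> e.1 \in arrows D.
Proof. by case: e => a [] eD; [rewrite (mem_arrows D a).1 | rewrite (mem_arrows D a).2]. Qed.

Lemma rename_inj : {in code D &, injective rename}.
Proof.
move=> [a b] [a' b'] /arrow_of_endpoint aD /arrow_of_endpoint aD' [e ->].
by rewrite (s_inj _ _ e).
Qed.

Lemma perm_arrows_rename : perm_eq (arrows D') (map s (arrows D)).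
Proof.
rewrite /arrows D'E.
rewrite (permPl (perm_map _ (perm_filter _ (permEl (perm_rot k _))))).
by rewrite filter_map -!map_comp.
Qed.

Lemma arc_rename x y : x \in code D -> y \in code D ->
  arc (code D') (rename x) (rename y) = map rename (arc (code D) x y).
Proof.
move=> xD yD; have /andP[uD' _] := codeP D'.
rewrite D'E arc_rot; last 2 first.
- by rewrite -(rot_uniq k) -D'E.
- exact: map_f.
rewrite /arc index_map_in //; last exact: rename_inj.
rewrite -map_rot index_map_in ?mem_rot ?map_take //.
by move=> z z'; rewrite !mem_rot; apply: rename_inj.
Qed.

Lemma meets_rename a e : a \in arrows D -> e \in code D ->
  meets D' (s a) (rename e) = meets D a e.
Proof.
move=> aD eD; rewrite /meets (arc_rename (x := tail_of a) (y := head_of a));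
  rewrite -?mem_arrows //.
have sub z : z \in arc (code D) (tail_of a) (head_of a) -> z \in code D.
  by rewrite /arc => /mem_take; rewrite mem_rot.
apply/mapP/idP => [[z zin]|]; last by exists e.
by move/rename_inj => /(_ eD (sub _ zin)) ->.
Qed.

Lemma crosses_rename a b : a \in arrows D -> b \in arrows D ->
  crosses D' (s a) (s b) = crosses D a b.
Proof.
move=> aD bD; rewrite /crosses (inj_in_eq s_inj) //.
by rewrite (meets_rename (e := tail_of b)) ?(meets_rename (e := head_of b)) -?mem_arrows.
Qed.

(** A coloring of a closed diagram is the cyclic list of the colors after each
    endpoint, which turns with the endpoints; the color at the new base point is
    the last one met. *)
Definition turned (c : gap_colors X D) (c' : gap_colors X D') :=
  behead c' = rot k (behead c) /\
  thead c' = last (thead c) (rot k (behead c)).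

Lemma passages_rename (x : X) (w : word) (t : seq X) :
  passages x (map rename w) t = [seq (rename i.1, i.2) | i <- passages x w t].
Proof. by elim: w x t => [|e w IH] x [|y t] //=; rewrite IH. Qed.

(** The old base point becomes an interior point; the colors on its two sides
    agree because the list closes up. *)
Lemma passages_rot (x : X) (w : word) (t : seq X) :
    size t = size w -> last x t = x ->
  perm_eq (passages (last x (rot k t)) (rot k w) (rot k t)) (passages x w t).
Proof.
move=> szt; have [lt_kw | le_wk] := ltnP k (size w); last first.
  by rewrite !rot_oversize ?szt // => ->.
have [t1 [t2 [-> sz1 sz2]]] : exists t1 t2,
    [/\ t = t1 ++ t2, size t1 = k & size t2 = size w - k].
  by apply: size_split; rewrite szt subnKC // ltnW.
have -> : rot k (t1 ++ t2) = t2 ++ t1 by rewrite -sz1 rot_size_cat.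
rewrite -{2}(cat_take_drop k w) /rot.
rewrite !last_cat => closed.
have sw1 : size t1 = size (take k w) by rewrite size_takel // ltnW.
have sw2 : size t2 = size (drop k w) by rewrite size_drop.
rewrite !passages_cat //.
have -> : last (last x t2) t1 = last x t1.
  by case: (t1) closed => //= ->.
by rewrite closed perm_catC.
Qed.

Lemma gap_passages_turned (c : gap_colors X D) (c' : gap_colors X D') :
    last (thead c) (behead c) = thead c -> turned c c' ->
  perm_eq (gap_passages c') [seq (rename i.1, i.2) | i <- gap_passages c].
Proof.
move=> closed [tE xE]; rewrite /gap_passages -passages_rename tE xE D'E.
by apply: passages_rot; rewrite // size_map size_behead_colors.
Qed.

Section Turned.
Variables (c : gap_colors X D) (c' : gap_colors X D').
Hypotheses (closed : last (thead c) (behead c) = thead c) (cc' : turned c c').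

Lemma colors_turned e : e \in code D ->
  color_before c' (rename e) = color_before c e /\
  color_after c' (rename e) = color_after c e.
Proof.
move=> eD.
have : (rename e, (color_before c e, color_after c e)) \in gap_passages c'.
  rewrite (perm_mem (gap_passages_turned closed cc')).
  apply/mapP; exists (e, (color_before c e, color_after c e)) => //.
  by rewrite mem_gap_passages eD eqxx.
by rewrite mem_gap_passages => /andP[_ /eqP[-> ->]].
Qed.

Lemma is_coloring_turned : is_coloring c = is_coloring c'.
Proof.
have closed' : last (thead c') (behead c') = thead c'.
  case: cc' => -> ->; case: (rot k _) (size_rot k (behead c)) => //.
have pm := gap_passages_turned closed cc'.
have inD i : i \in gap_passages c -> i.1 \in code D.
  by case: i => e p; rewrite mem_gap_passages => /andP[].
apply/is_coloringP/is_coloringP => -[_ cp]; split=> //.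
  move=> a h t; rewrite !(perm_mem pm).
  case/mapP=> [[[a1 b1] h1] i1 [-> e1 ->]]; case/mapP=> [[[a2 b2] h2] i2 [+ e2 ->]].
  rewrite /= in e1 e2; subst b1 b2.
  have a1D := arrow_of_endpoint (inD _ i1); have a2D := arrow_of_endpoint (inD _ i2).
  move/(s_inj a1D a2D) => /= e; subst a2; rewrite s_sign //.
  exact: cp i1 i2.
move=> a h t ah at_; rewrite -s_sign; last exact: (arrow_of_endpoint (inD _ ah)).
by apply: cp; rewrite (perm_mem pm); [move: ah | move: at_] => /(map_f _); apply.
Qed.

Lemma label_turned a : a \in arrows D -> label c' (s a) = label c a.
Proof.
move=> aD; rewrite /label s_sign //.
have [-> ->] := colors_turned (e := head_of a) (etrans (esym (mem_arrows D a).1) aD).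
by have [-> ->] := colors_turned (e := tail_of a) (etrans (esym (mem_arrows D a).2) aD).
Qed.

Lemma Sigma_turned : Sigma W c' = Sigma W c.
Proof.
rewrite /Sigma (perm_big _ perm_arrows_rename) big_map.
apply: eq_big_seq => a aD.
rewrite (perm_big _ perm_arrows_rename) big_map big_seq_cond [RHS]big_seq_cond.
apply: eq_big => [b|b /andP[bD _]].
  case bD: (b \in arrows D) => //=; rewrite crosses_rename //.
  by rewrite (meets_rename (e := tail_of b)) -?mem_arrows.
by rewrite !label_turned // /arrow_sign !s_sign.
Qed.

End Turned.

Lemma size_rot_code (t : seq X) :
  (size (rot k t) == size (code D')) = (size t == size (code D)).
Proof. by rewrite D'E !size_rot size_map. Qed.

Lemma thead_endo D0 (phi : biq_endo X) (c : gap_colors X D0) :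
  thead (endo_colors phi c) = val phi (thead c).
Proof. by case/tupleP: c => x t; rewrite !theadE. Qed.

Lemma homeo_match : coloring_match D D'.
Proof.
have closedP D0 (c : gap_colors X D0) :
    is_coloring c -> last (thead c) (behead c) = thead c by case/is_coloringP.
have ext D0 (c1 c2 : gap_colors X D0) :
    thead c1 = thead c2 -> behead c1 = behead c2 -> c1 = c2.
  by move=> e1 e2; apply: val_inj; rewrite /= gap_colorsE [RHS]gap_colorsE e1 e2.
have last_last (x : X) t : last (last x t) t = last x t by case: t.
apply: (@coloring_match_rel _ _ turned).
- move=> c col.
  pose t' := rot k (behead c).
  have sz : size (last (thead c) t' :: t') == (size (code D')).+1.
    by rewrite /= eqSS size_rot_code size_behead_colors.
  pose c' : gap_colors X D' := Tuple sz.
  have cc' : turned c c' by [].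
  by exists c' => //; rewrite -(is_coloring_turned (closedP _ _ col) cc').
- move=> c' col.
  pose t := rotr k (behead c').
  have sz : size (last (thead c') t :: t) == (size (code D)).+1.
    by rewrite /= eqSS -size_rot_code /t rotrK size_behead_colors.
  pose c : gap_colors X D := Tuple sz.
  have closed : last (thead c) (behead c) = thead c by exact: last_last.
  have cc' : turned c c'.
    split; rewrite -[behead c]/(t) /t rotrK //.
    have := closedP _ _ col; rewrite -[thead c]/(last _ t) /t.
    by case: (behead c') => [|y t'] //= ->.
  by exists c => //; rewrite (is_coloring_turned closed cc').
- by move=> c c1 c2 _ _ _ [t1 x1] [t2 x2]; apply: ext; rewrite ?t1 ?t2 ?x1 ?x2.
- move=> c1 c2 c' /closedP cl1 /closedP cl2 _ [t1 x1] [t2 x2].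
  have et : behead c1 = behead c2 by apply: (@rot_inj k); rewrite -t1.
  apply: ext => //; rewrite et in x1 cl1.
  case: (behead c2) x1 x2 cl1 cl2 => [|y t]; first by move=> /= <- <-.
  by move=> _ _ /= <- <-.
- move=> phi c c' [tE xE]; rewrite /turned !thead_endo /= !behead_map tE xE.
  by rewrite -map_rot last_map.
- by move=> c c' /closedP cl _; apply: Sigma_turned.
Qed.

End Homeo.

(** * Invariance of the quiver *)

Lemma same_knot_match (hW : arrow_weight W) D D' :
  same_virtual_knot D D' -> coloring_match D D'.
Proof.
elim=> [{}D {}D' [[s [k [s_inj s_sign D'E]]]|mv]|{}D|{}D {}D' _ mD|D1 D2 D3 _ m12 _ m23].
- exact: homeo_match s_inj s_sign D'E.
- exact: reidemeister_match.
- exact: coloring_match_refl.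
- exact: coloring_match_sym.
- exact: coloring_match_trans m12 m23.
Qed.

End Matching.

Theorem proposition2 (X : finBiquandleType) (A : zmodType)
    (W : (X * X) * (X * X) -> A) (hW : arrow_weight W)
    (S : {set biq_endo X}) (D D' : gauss_diagram)
    (hDD' : same_virtual_knot D D') :
  quiver_iso (coloring_quiver W S D) (coloring_quiver W S D').
Proof.
have [f [[g fK gK] fE fS]] := same_knot_match hW hDD'.
exists f, (fun e => (f e.1, e.2)); split=> //=; first by exists g.
by exists (fun e => (g e.1, e.2)) => -[c phi] /=; rewrite ?fK ?gK.
Qed.
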